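(* (2D) Let $S_2\subseteq\mathbb{Z}^2$ be the configuration consisting of the boundary cells of a $5\times5$ square (a hollow $5\times 5$ square, i.e. $\{0,\dots,4\}^2\setminus\{1,2,3\}^2$) together with the four corner cells $\{1,3\}^2$ of the concentric $3\times3$ square. Then $S_2$ cannot be reconfigured into a straight line by any sequence of $3$-loose slides. (3D) Let $S_3\subseteq\mathbb{Z}^3$ be the configuration consisting of the boundary cells of a $5\times5\times5$ cube (a hollow $5\times5\times5$ cube, i.e. $\{0,\dots,4\}^3\setminus\{1,2,3\}^3$) together with the eight corner cells $\{1,3\}^3$ of the concentric $3\times3\times3$ cube. Then $S_3$ cannot be reconfigured into a straight line by any sequence of $3$-loose slides.
   Context: Sliding-cubes (sliding-squares) model in dimension $D\in\{2,3\}$. A configuration is a finite set of cells of the lattice $\mathbb{Z}^D$; a cell in the set is occupied by a unit module, all other cells are empty. A configuration is connected if its facet-adjacency graph is connected. Modules are moved one at a time by slides, and the configuration must be connected after every slide. Slides are of two types. Let a module be at cell $p$, and let $u,d$ be perpendicular axis-parallel unit vectors. (1) Straight slide: if $p+u$ and $p+u+d$ are occupied and $p+d$ is empty, the module moves from $p$ to $p+d$ (one unit step). (2) Corner slide: if $p+u$ is occupied and $p+d$ and $p+d+u$ are empty, the module moves from $p$ to $p+d$ and then to $p+d+u$ (two unit steps). A $k$-cube is an axis-aligned box of cells with side length $k$ in each of the $D$ dimensions ($k\times k$ square if $D=2$). While a module is moving, ''empty'' $k$-cube means containing no module other than the moving one. A slide is $k$-loose if for each of its unit steps both the start and end position of the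 moving module in that step lie in a common empty $k$-cube, and moreover, for a corner slide, the empty $k$-cube used for the first step can be translated by unit axis-parallel steps to the empty $k$-cube used for the second step, staying empty of other modules (and containing the moving module at all times) throughout. *)

(* Defs.v *)
From Stdlib Require Import Relation_Operators.
From mathcomp Require Import all_boot all_order all_algebra finmap.

Set Implicit Arguments.
Unset Strict Implicit.
Unset Printing Implicit Defensive.

Import Order.TTheory GRing.Theory Num.Theory.

Local Open Scope fset_scope.
Local Open Scope ring_scope.

Notation cell D := 'rV[int]_D.
Notation config D := {fset 'rV[int]_D}.

Section SlidingCubes.

Variable D : nat.
Implicit Types (p q u d a b : cell D) (S T O : config D) (k : nat).

Definition unit_vector u : bool :=
  [exists i, (u == delta_mx 0 i) || (u == - delta_mx 0 i)].

Definition perpendicular u d : Prop := u *m d^T = 0.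

Definition adjacent p q : bool := unit_vector (q - p).

Definition connected S : Prop :=
  forall x y : S, connect (fun v w : S => adjacent (val v) (val w)) x y.

(* A k-cube is represented by its cell [a] with minimal coordinates. *)
Definition kcube k a : pred (cell D) :=
  [pred q : cell D | [forall i, a 0 i <= q 0 i < a 0 i + k%:Z]].

(* Below, [O] stands for the set of the modules other than the moving one. *)
Definition empty_kcube k O a : Prop := forall q, q \in O -> q \notin kcube k a.

Definition loose_step k O a p q : Prop :=
  [/\ empty_kcube k O a, p \in kcube k a & q \in kcube k a].

(* One unit translation of an empty k-cube while the moving module rests at
   [r]. *)
Definition cube_shift k O (r : cell D) a b : Prop :=
  unit_vector (b - a) /\
  (empty_kcube k O a /\ r \in kcube k a) /\
  (empty_kcube k O b /\ r \in kcube k b).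

Definition straight_slide S p u d : Prop :=
  [/\ p \in S, p + u \in S, p + u + d \in S & p + d \notin S].

Definition corner_slide S p u d : Prop :=
  [/\ p \in S, p + u \in S, p + d \notin S & p + d + u \notin S].

Definition straight_loose k S p d : Prop :=
  exists a, loose_step k (S `\ p) a p (p + d).

(* Between its two unit steps the moving module is at [p + d]: this is the cell
   that the translated cube has to contain throughout. *)
Definition corner_loose k S p u d : Prop :=
  exists a b,
    [/\ loose_step k (S `\ p) a p (p + d),
        loose_step k (S `\ p) b (p + d) (p + d + u) &
        clos_refl_trans _ (cube_shift k (S `\ p) (p + d)) a b].

Inductive loose_slide k S : config D -> Prop :=
| LooseStraight p u d :
    unit_vector u -> unit_vector d -> perpendicular u d ->
    straight_slide S p u d -> straight_loose k S p d ->
    loose_slide k S ((p + d) |` (S `\ p))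
| LooseCorner p u d :
    unit_vector u -> unit_vector d -> perpendicular u d ->
    corner_slide S p u d -> corner_loose k S p u d ->
    loose_slide k S ((p + d + u) |` (S `\ p)).

Definition loose_move k S T : Prop := loose_slide k S T /\ connected T.

Definition loosely_reconfigurable k : config D -> config D -> Prop :=
  clos_refl_trans _ (loose_move k).

Definition straight_line T : Prop :=
  exists p u n, unit_vector u /\ T = [fset p + u *+ val j | j in 'I_n.+1].

End SlidingCubes.

(* The cartesian power A^D as a set of cells. *)
Definition fset_power (D : nat) (A : {fset int}) : config D :=
  [fset \row_i val (f i) | f : {ffun 'I_D -> A} in predT].

Lemma in_fset_power (D : nat) (A : {fset int}) (p : cell D) :
  (p \in fset_power D A) = [forall i, p 0 i \in A].
Proof.
apply/imfsetP/forallP => [[f _ -> i]|pA]; first by rewrite mxE; exact: fsvalP.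
exists [ffun i => [` pA i]] => //.
by apply/rowP => i; rewrite mxE ffunE.
Qed.

Definition hollow_with_corners (D : nat) : config D :=
  (fset_power D [fset 0; 1; 2; 3; 4]%Z `\` fset_power D [fset 1; 2; 3]%Z)
  `|` fset_power D [fset 1; 3]%Z.

(* Main.v *)
(** While the cells [{1,3}^D] are exactly the occupied cells of the box
    [{1,2,3}^D], every 3-cube meeting the box contains one of the cells
    [{1,3}^D], so no module can enter the box.  A module [c] of [{1,3}^D] cannot
    leave either: connectivity gives it an occupied neighbour, which lies outside
    the box, on the side of [c] away from the centre; and a 3-cube that contains
    [c] and avoids the mirror image of [c] in that direction must contain this
    neighbour.  A straight line cannot contain [{1,3}^D] once [D >= 2]. *)
Require Import Defs.
From mathcomp Require Import all_boot all_order all_algebra finmap.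
From mathcomp Require Import zify.

Set Implicit Arguments.
Unset Strict Implicit.
Unset Printing Implicit Defensive.

Import Order.TTheory GRing.Theory Num.Theory.

Local Open Scope fset_scope.
Local Open Scope ring_scope.

(** Unit steps and reflections both change a single coordinate, so the geometry reduces to integer
    inequalities in that coordinate. *)
Definition set_coord D (p : cell D) i (v : int) : cell D :=
  \row_j (if j == i then v else p 0 j).

Lemma adjacent_set_coord D (p q : cell D) :
  adjacent p q ->
  exists i v, [/\ q = set_coord p i v & v = p 0 i + 1 \/ v = p 0 i - 1].
Proof.
have coord i (s : int) :
  q - p = s *: delta_mx 0 i -> q = set_coord p i (p 0 i + s).
  move=> e; apply/rowP => j; rewrite -(subrK p q) e !mxE eqxx /=.
  by case: eqP => [->|_]; lia.
case/existsP=> i /orP[] /eqP e; exists i.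
- by exists (p 0 i + 1); split; [apply: coord; rewrite scale1r|left].
- by exists (p 0 i - 1); split; [apply: coord; rewrite scaleN1r|right].
Qed.

Lemma set_coord_adjacent D (p : cell D) i v :
  v = p 0 i + 1 \/ v = p 0 i - 1 -> adjacent p (set_coord p i v).
Proof.
move=> vP; apply/existsP; exists i; apply/orP.
by case: vP => ->; [left|right]; apply/eqP/rowP => j; rewrite !mxE eqxx /=;
  case: (eqVneq j i) => [->|_] /=; lia.
Qed.

Lemma connected_neighbour D (S : config D) (p q : cell D) :
  connected S -> p \in S -> q \in S -> p != q ->
  exists2 r, r \in S & adjacent p r.
Proof.
move=> connS pS qS /eqP neq_pq.
(* The first vertex after [p] on a path to [q] is the neighbour; an empty path would force
   [p = q]. *)
have /connectP[[|r s] /= pth lst] := connS [` pS] [` qS].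
  by case: neq_pq; have := congr1 val lst.
by case/andP: pth => adj _; exists (val r); [exact: fsvalP|].
Qed.

Notation box D := (fset_power D [fset 1; 2; 3]%Z).
Notation box_corners D := (fset_power D [fset 1; 3]%Z).

Lemma boxP D (p : cell D) :
  reflect (forall i, (1 <= p 0 i <= 3)%R) (p \in box D).
Proof.
rewrite in_fset_power; apply: (iffP forallP) => h i; have := h i; rewrite !inE;
  lia.
Qed.

Lemma box_cornersP D (p : cell D) :
  reflect (forall i, p 0 i = 1 \/ p 0 i = 3) (p \in box_corners D).
Proof.
rewrite in_fset_power; apply: (iffP forallP) => h i; have := h i; rewrite !inE;
  lia.
Qed.

Lemma box_corners_box D (c : cell D) : c \in box_corners D -> c \in box D.
Proof. by move=> /box_cornersP cP; apply/boxP => i; have := cP i; lia. Qed.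

Lemma kcubeP D k (a p : cell D) :
  reflect (forall i, a 0 i <= p 0 i < a 0 i + k%:Z) (p \in kcube k a).
Proof. by rewrite inE; apply: forallP. Qed.

Lemma kcube_set_coord D k (a p : cell D) i v :
  p \in kcube k a -> a 0 i <= v < a 0 i + k%:Z ->
  set_coord p i v \in kcube k a.
Proof.
move=> /kcubeP pa va; apply/kcubeP => j; rewrite mxE.
by case: eqP => [->|_].
Qed.

(** [4 - x] is the reflection in the centre 2 of the box; it swaps 1 and 3. *)
Lemma mirror_box_corner D (c : cell D) i :
  c \in box_corners D -> set_coord c i (4 - c 0 i) \in box_corners D.
Proof.
move=> /box_cornersP cP; apply/box_cornersP => j; rewrite mxE.
by case: eqP => [_|_]; [have := cP i; lia|].
Qed.

Lemma mirror_box_corner_neq D (c : cell D) i :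
  c \in box_corners D -> set_coord c i (4 - c 0 i) != c.
Proof.
move=> /box_cornersP/(_ i) cP; apply/eqP => /rowP/(_ i).
by rewrite mxE eqxx /=; lia.
Qed.

(** In each coordinate, an interval of length 3 that meets [1..3] contains 1 if it starts at or
    below 1, and 3 otherwise. These choices assemble into a corner lying in the cube. *)
Lemma empty_3cube_avoids_box D (O : config D) (a p : cell D) :
  (forall c, c \in box_corners D -> c \in O) ->
  empty_kcube 3 O a -> p \in kcube 3 a -> p \notin box D.
Proof.
move=> cornersO emp /kcubeP pa; apply/negP => /boxP pbox.
have cO : (\row_i (if a 0 i <= 1 then 1 else 3) : cell D) \in O.
  apply/cornersO/box_cornersP => i; rewrite mxE.
  by case: ifP => _; [left|right].
move/negP: (emp _ cO); apply; apply/kcubeP => i; rewrite mxE.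
by have := pa i; have := pbox i; case: ifP; lia.
Qed.

(** The invariant of the proof. Its second clause is the local trace of connectivity; in this form
    one explicit neighbour per corner settles the initial configuration. *)
Definition locked_box D (S : config D) : Prop :=
  (forall p, p \in box D -> (p \in S) = (p \in box_corners D)) /\
  (forall c, c \in box_corners D -> exists2 r, r \in S & adjacent c r).

Lemma locked_box_corner D (S : config D) (c : cell D) :
  locked_box S -> c \in box_corners D -> c \in S.
Proof. by move=> [boxS _] cC; rewrite boxS// box_corners_box. Qed.

Lemma locked_box_corner_stuck D (S : config D) (a c : cell D) :
  locked_box S -> c \in box_corners D -> empty_kcube 3 (S `\ c) a ->
  c \notin kcube 3 a.
Proof.
move=> lockS cC emp; apply/negP => ca.
have [r rS /adjacent_set_coord[i [v [def_r vP]]]] := lockS.2 _ cC.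
have ciP := box_cornersP _ cC i.
(* [v = 2] would put the neighbour [r] in the box at a non-corner, where no module lies; hence [r]
   is on the outer side of [c]. *)
have vout : v = 0 /\ c 0 i = 1 \/ v = 4 /\ c 0 i = 3.
  suff: v <> 2 by lia.
  move=> v2; have rbox : r \in box D.
    apply/boxP => j; rewrite def_r mxE v2; case: eqP => // _.
    by have := boxP _ (box_corners_box cC) j.
  move: rS; rewrite lockS.1// => /box_cornersP/(_ i).
  by rewrite def_r mxE eqxx v2; lia.
have r_neq_c : r != c.
  by apply/eqP => /rowP/(_ i); rewrite def_r mxE eqxx /=; lia.
have /emp/negP mirror_out : set_coord c i (4 - c 0 i) \in S `\ c.
  rewrite in_fsetD1 mirror_box_corner_neq//=.
  by apply: (locked_box_corner lockS); apply: mirror_box_corner.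
have /emp/negP : r \in S `\ c by rewrite in_fsetD1 r_neq_c.
apply; rewrite def_r; apply: kcube_set_coord => //.
have {}mirror_out : ~ (a 0 i <= 4 - c 0 i < a 0 i + 3%:Z).
  by move=> h; apply/mirror_out/kcube_set_coord.
(* An interval of length 3 that contains 1 but not 3 starts at -1 or 0, so it contains 0;
   symmetrically, 3 without 1 forces 4. *)
by have := kcubeP _ _ _ ca i; lia.
Qed.

Lemma locked_box_loose_step D (S : config D) (a p q : cell D) :
  locked_box S -> p \in S -> loose_step 3 (S `\ p) a p q ->
  p \notin box D.
Proof.
move=> lockS pS [emp pa _]; apply/negP => pbox.
have pC : p \in box_corners D by rewrite -lockS.1.
by move/negP: (locked_box_corner_stuck lockS pC emp); apply.
Qed.

Lemma locked_box_displace D (S : config D) (p q : cell D) :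
  locked_box S -> p \notin box D -> q \notin box D ->
  forall x, x \in box D -> (x \in q |` (S `\ p)) = (x \in box_corners D).
Proof.
move=> lockS pbox qbox x xbox; rewrite !inE -lockS.1//.
have -> : x == q = false by apply/eqP => e; rewrite -e xbox in qbox.
by case: eqP => // e; rewrite -e xbox in pbox.
Qed.

Lemma loose_slide_box D (S T : config D) :
  locked_box S -> loose_slide 3 S T ->
  forall x, x \in box D -> (x \in T) = (x \in box_corners D).
Proof.
move=> lockS.
(* Common to both slides: the cube [a] of the first unit step shows that [p] starts outside the box,
   the cube [b] of the last one that [r] ends outside. A straight slide takes [b = a]. *)
have step p a b q r : p \in S -> loose_step 3 (S `\ p) a p q ->
    empty_kcube 3 (S `\ p) b -> r \in kcube 3 b ->
    forall x, x \in box D -> (x \in r |` (S `\ p)) = (x \in box_corners D).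
  move=> pS loose emp rb.
  have pbox := locked_box_loose_step lockS pS loose.
  apply: locked_box_displace => //.
  apply: (empty_3cube_avoids_box _ emp rb) => c cC.
  rewrite in_fsetD1 (locked_box_corner lockS cC) andbT.
  by apply/eqP => e; rewrite -e box_corners_box in pbox.
case=> p u d _ _ _ [pS _ _ _].
  by case=> a loose; case: (loose) => emp _; apply: step loose emp.
by case=> a [b [loose [emp _ rb] _]]; apply: step loose emp rb.
Qed.

Lemma locked_box_loose_move D (S T : config D.+1) :
  locked_box S -> loose_move 3 S T -> locked_box T.
Proof.
move=> lockS [slide connT]; have boxT := loose_slide_box lockS slide.
split=> // c cC.
(* Connectivity yields a neighbour of [c] once a second module is known; the mirror image in
   coordinate 0 is one. *)
apply: (@connected_neighbour _ _ _ (set_coord c 0 (4 - c 0 0))) => //.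
- by rewrite boxT// box_corners_box.
- have mC := mirror_box_corner 0 cC.
  by rewrite boxT// box_corners_box.
- by rewrite eq_sym mirror_box_corner_neq.
Qed.

Lemma locked_box_hollow_with_corners D :
  locked_box (hollow_with_corners D.+1).
Proof.
split=> [p pbox|c cC]; first by rewrite !inE pbox.
have ciP := box_cornersP _ cC.
(* [2 * x - 2] sends 1 to 0 and 3 to 4: the witness is the cell of the outer shell next to [c]. *)
exists (set_coord c 0 (2 * c 0 0 - 2)); last first.
  by apply: set_coord_adjacent; case: (ciP 0) => ->; [right|left].
rewrite !inE; apply/orP; left; apply/andP; split.
  by apply/negP => /boxP/(_ 0); rewrite mxE eqxx /=; have := ciP 0; lia.
rewrite in_fset_power; apply/forallP => i; rewrite mxE !inE.
by case: ifP => _; [case: (ciP 0) => ->|case: (ciP i) => ->].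
Qed.

Lemma locked_box_reconfigurable D (S T : config D.+1) :
  locked_box S -> loosely_reconfigurable 3 S T -> locked_box T.
Proof.
by move=> lockS reach; elim: reach lockS => [? ? mv /locked_box_loose_move|//|];
  [exact|move=> ? ? ? _ ih1 _ ih2 /ih1].
Qed.

(** Only the coordinate [l] of the direction varies along the line, and [i], [j] cannot both be
    [l]. *)
Lemma straight_line_coord D (T : config D) (p q : cell D) i j :
  straight_line T -> p \in T -> q \in T -> i != j ->
  p 0 i = q 0 i \/ p 0 j = q 0 j.
Proof.
case=> [o [u [n [/existsP[l uP] ->]]]] /imfsetP[x _ ->] /imfsetP[y _ ->] /= ij.
have u0 m : m != l -> u 0 m = 0.
  by move=> /negPf ml; case/orP: uP => /eqP->; rewrite !mxE ml andbF ?oppr0.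
have coord m : m != l -> (o + u *+ val x) 0 m = (o + u *+ val y) 0 m.
  by move=> /u0 um; rewrite !mxE !mulmxnE um !mul0rn.
case: (eqVneq i l) => [il|/coord]; last by left.
by right; apply: coord; rewrite -il eq_sym.
Qed.

Lemma locked_box_not_straight_line D (T : config D.+2) :
  locked_box T -> ~ straight_line T.
Proof.
move=> lockT lineT.
have cT v : v = 1 \/ v = 3 -> (const_mx v : cell D.+2) \in T.
  move=> vP; apply: (locked_box_corner lockT).
  by apply/box_cornersP => i; rewrite mxE.
(* The opposite corners [(1, ..., 1)] and [(3, ..., 3)] differ in every coordinate, in particular in
   the two that [D.+2] provides. *)
have := straight_line_coord lineT (cT 1 (or_introl erefl))
  (cT 3 (or_intror erefl)) (isT : 0 != 1 :> 'I_D.+2).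
by rewrite !mxE; case.
Qed.

Lemma hollow_with_corners_not_reconfigurable D (T : config D.+2) :
  straight_line T -> ~ loosely_reconfigurable 3 (hollow_with_corners D.+2) T.
Proof.
move=> lineT /locked_box_reconfigurable lockT.
apply: locked_box_not_straight_line lineT.
by apply: lockT; apply: locked_box_hollow_with_corners.
Qed.

Theorem mainTheorem3 :
  (~ exists T : config 2,
       straight_line T /\
       loosely_reconfigurable 3 (hollow_with_corners 2) T) /\
  (~ exists T : config 3,
       straight_line T /\
       loosely_reconfigurable 3 (hollow_with_corners 3) T).
Proof.
by split=> -[T [lineT]]; apply: hollow_with_corners_not_reconfigurable.
Qed.
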